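(* Let $n\ge 4$ and let $x_1,x_2,\dots,x_n$ be $n$ positive real numbers, with geometric mean $G$ and moments $m_1',m_2',m_3',m_4'$. Then $$G^{4}\leq \frac{1}{(n-1)(n-2)(n-3)}\left(n^{3}m_{1}'^{\,4}-6n^{2}m_{2}'m_{1}'^{\,2}+8n\,m_{3}'m_{1}'+3n\,m_{2}'^{\,2}-6m_{4}'\right).$$
   Context: For positive real numbers $x_1,\dots,x_n$: $G=\left(\prod_{i=1}^n x_i\right)^{1/n}$, and $m_r'=\frac1n\sum_{i=1}^n x_i^r$ for $r=1,2,3,4$; $m_r'^{\,k}$ means $(m_r')^k$. *)

(* Defs.v *)
From mathcomp Require Import all_boot all_order all_algebra.
From mathcomp Require Import all_classical all_reals all_analysis.
Set Implicit Arguments.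
Unset Strict Implicit.
Unset Printing Implicit Defensive.
Import Order.TTheory GRing.Theory Num.Theory.
Local Open Scope ring_scope.

Definition geometric_mean (R : realType) (n : nat) (x : 'I_n -> R) : R :=
  (\prod_(i < n) x i) `^ (1 / n%:R).

Definition raw_moment (R : realType) (n : nat) (x : 'I_n -> R) (r : nat) : R :=
  1 / n%:R * \sum_(i < n) x i ^+ r.

(* Main.v *)
Require Import Defs.
From mathcomp Require Import all_boot all_order all_algebra.
From mathcomp Require Import all_classical all_reals all_analysis.
From mathcomp Require Import ring lra.
Import Order.TTheory GRing.Theory Num.Theory.
Local Open Scope ring_scope.

(** The right-hand side is the average of [x a * x b * x c * x d] over ordered
    quadruples of distinct indices. With [l i := ln (x i / G)], the bound
    [1 + t <= exp t] gives
    [G ^+ 4 * (1 + l a + l b + l c + l d) <= x a * x b * x c * x d]; on averaging,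
    the linear part disappears because the [l i] sum to zero. *)

Section DistinctIndexSums.
Context {V : zmodType} {I : finType}.
Implicit Types (f : I -> V) (a b c : I).

Lemma sum_neq1 f a : \sum_(i | i != a) f i = \sum_i f i - f a.
Proof. by rewrite [in RHS](bigD1 a) //= addrAC subrr add0r. Qed.

Lemma sum_neq2 f a b : b != a ->
  \sum_(i | (i != a) && (i != b)) f i = \sum_i f i - f a - f b.
Proof. by move=> ba; rewrite -sum_neq1 [in RHS](bigD1 b) //= addrAC subrr add0r. Qed.

Lemma sum_neq3 f a b c : b != a -> (c != a) && (c != b) ->
  \sum_(i | (i != a) && (i != b) && (i != c)) f i
  = \sum_i f i - f a - f b - f c.
Proof.
by move=> ba cab; rewrite -sum_neq2 // [in RHS](bigD1 c) //= addrAC subrr add0r.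
Qed.

(** The sum is nested, each index avoiding the earlier ones, so that it can be evaluated from the
    inside out, one layer at a time. *)
Definition distinct4_sum (F : I -> I -> I -> I -> V) : V :=
  \sum_a \sum_(b | b != a) \sum_(c | (c != a) && (c != b))
    \sum_(d | (d != a) && (d != b) && (d != c)) F a b c d.

End DistinctIndexSums.

(** This is Newton's expression of [4! * e_4] in power sums, [e_4] being the elementary symmetric
    polynomial. An inner sum is the full sum minus the excluded terms, so each layer leaves a
    polynomial in the outer variables whose coefficients are power sums. *)
Lemma distinct4_sum_prod (R : comRingType) (I : finType) (x : I -> R) :
  let p r := \sum_i x i ^+ r in
  distinct4_sum (fun a b c d => x a * x b * x c * x d) =
  p 1 ^+ 4 - 6 * p 2 * p 1 ^+ 2 + 8 * p 3 * p 1 + 3 * p 2 ^+ 2 - 6 * p 4.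
Proof.
move=> p.
have p1E : \sum_i x i = p 1 by apply: eq_bigr => i _; rewrite expr1.
have step3 a b c : b != a -> (c != a) && (c != b) ->
    \sum_(d | (d != a) && (d != b) && (d != c)) x a * x b * x c * x d
    = x a * x b * ((p 1 - x a - x b) * x c - x c ^+ 2).
  by move=> ba cab; rewrite -mulr_sumr sum_neq3 // p1E; ring.
have step2 a b : b != a ->
    \sum_(c | (c != a) && (c != b))
      x a * x b * ((p 1 - x a - x b) * x c - x c ^+ 2)
    = x a * ((p 1 ^+ 2 - p 2 - 2 * p 1 * x a + 2 * x a ^+ 2) * x b
             - 2 * (p 1 - x a) * x b ^+ 2 + 2 * x b ^+ 3).
  move=> ba; rewrite -mulr_sumr sumrB -mulr_sumr !sum_neq2 // p1E -/(p 2).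
  by ring.
have step1 a :
    \sum_(b | b != a)
      x a * ((p 1 ^+ 2 - p 2 - 2 * p 1 * x a + 2 * x a ^+ 2) * x b
             - 2 * (p 1 - x a) * x b ^+ 2 + 2 * x b ^+ 3)
    = (p 1 ^+ 3 - 3 * p 1 * p 2 + 2 * p 3) * x a
      - 3 * (p 1 ^+ 2 - p 2) * x a ^+ 2 + 6 * p 1 * x a ^+ 3 - 6 * x a ^+ 4.
  rewrite -mulr_sumr big_split sumrB /= -!mulr_sumr !sum_neq1 p1E.
  by rewrite -/(p 2) -/(p 3); ring.
transitivity (\sum_a ((p 1 ^+ 3 - 3 * p 1 * p 2 + 2 * p 3) * x a
      - 3 * (p 1 ^+ 2 - p 2) * x a ^+ 2 + 6 * p 1 * x a ^+ 3 - 6 * x a ^+ 4)).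
  apply: eq_bigr => a _; rewrite -step1; apply: eq_bigr => b ba.
  by rewrite -step2 //; apply: eq_bigr => c cab; rewrite step3.
rewrite sumrB big_split sumrB /= -!mulr_sumr p1E -/(p 2) -/(p 3) -/(p 4).
by ring.
Qed.

(** Each layer stays affine in the outer values of [l], and the last, unrestricted sum over [a]
    kills the linear term. What remains counts the ordered quadruples of distinct indices. *)
Lemma distinct4_sum_affine (R : comRingType) (I : finType) (l : I -> R) :
  let n : R := #|I|%:R in
  \sum_i l i = 0 ->
  distinct4_sum (fun a b c d => 1 + l a + l b + l c + l d) =
  n * (n - 1) * (n - 2) * (n - 3).
Proof.
move=> n l0.
have cst (u : R) : \sum_(i : I) u = n * u by rewrite sumr_const mulr_natl.
(* The coefficient [n - 4] arises as [(n - 3) - 1]: there are [n - 3] choices of [d], and since [l]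
   sums to zero, the values [l d] add up to [- (l a + l b + l c)]. *)
have step3 a b c : b != a -> (c != a) && (c != b) ->
    \sum_(d | (d != a) && (d != b) && (d != c)) (1 + l a + l b + l c + l d)
    = (n - 3) + (n - 4) * (l a + l b) + (n - 4) * l c.
  by move=> ba cab; rewrite sum_neq3 // big_split /= cst l0; ring.
have step2 a b : b != a ->
    \sum_(c | (c != a) && (c != b))
      ((n - 3) + (n - 4) * (l a + l b) + (n - 4) * l c)
    = (n - 3) * (n - 2 + (n - 4) * l a) + (n - 3) * (n - 4) * l b.
  by move=> ba; rewrite sum_neq2 // big_split /= cst -mulr_sumr l0; ring.
have step1 a :
    \sum_(b | b != a)
      ((n - 3) * (n - 2 + (n - 4) * l a) + (n - 3) * (n - 4) * l b)
    = (n - 1) * (n - 2) * (n - 3) + (n - 2) * (n - 3) * (n - 4) * l a.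
  by rewrite sum_neq1 // big_split /= cst -mulr_sumr l0; ring.
transitivity (\sum_a ((n - 1) * (n - 2) * (n - 3)
                      + (n - 2) * (n - 3) * (n - 4) * l a)).
  apply: eq_bigr => a _; rewrite -step1; apply: eq_bigr => b ba.
  by rewrite -step2 //; apply: eq_bigr => c cab; rewrite step3.
by rewrite big_split /= cst -mulr_sumr l0; ring.
Qed.

Lemma ln_prod (R : realType) (I : Type) (s : seq I) (x : I -> R) :
  (forall i, 0 < x i) -> ln (\prod_(i <- s) x i) = \sum_(i <- s) ln (x i).
Proof.
move=> x0; elim: s => [|i s IHs]; first by rewrite !big_nil ln1.
by rewrite !big_cons lnM ?IHs // posrE // prodr_gt0.
Qed.

Lemma geometric_mean_gt0 (R : realType) (n : nat) (x : 'I_n -> R) :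
  (forall i, 0 < x i) -> 0 < geometric_mean x.
Proof. by move=> x0; rewrite powR_gt0 // prodr_gt0. Qed.

(** The logarithm of the geometric mean is the average of the [ln (x i)], and deviations from an
    average cancel. *)
Lemma sum_ln_div_geometric_mean (R : realType) (n : nat) (x : 'I_n -> R) :
  (0 < n)%N -> (forall i, 0 < x i) ->
  \sum_i ln (x i / geometric_mean x) = 0.
Proof.
move=> n0 x0; have G0 := geometric_mean_gt0 _ _ _ x0.
under eq_bigr do rewrite ln_div ?posrE //.
rewrite sumrB sumr_const card_ord /geometric_mean ln_powR -ln_prod //.
by rewrite -[X in _ - X]mulr_natl mulrA mul1r mulfV ?mul1r ?subrr // pnatr_eq0 -lt0n.
Qed.

Lemma ln_div_bound4 (R : realType) (G a b c d : R) :
  0 < G -> 0 < a -> 0 < b -> 0 < c -> 0 < d ->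
  G ^+ 4 * (1 + ln (a / G) + ln (b / G) + ln (c / G) + ln (d / G))
  <= a * b * c * d.
Proof.
move=> G0 a0 b0 c0 d0; have Gn0 : G != 0 by rewrite gt_eqF.
have -> : a * b * c * d = G ^+ 4 * ((a / G) * (b / G) * (c / G) * (d / G)).
  by field.
rewrite ler_pM2l ?exprn_gt0 // -!addrA.
(* The exponential bound is used once, at the sum of the four logarithms; [expR] turns that sum back
   into the product of the ratios. *)
have /= := expR_ge1Dx (ln (a / G) + ln (b / G) + ln (c / G) + ln (d / G)).
by rewrite !expRD !lnK ?posrE ?divr_gt0 // !addrA.
Qed.

Theorem theorem2p8 (R : realType) (n : nat) (x : 'I_n -> R)
    (hn : (4 <= n)%N) (hx : forall i : 'I_n, 0 < x i) :
  geometric_mean x ^+ 4 <=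
    1 / ((n%:R - 1) * (n%:R - 2) * (n%:R - 3)) *
    (n%:R ^+ 3 * raw_moment x 1 ^+ 4
     - 6 * n%:R ^+ 2 * raw_moment x 2 * raw_moment x 1 ^+ 2
     + 8 * n%:R * raw_moment x 3 * raw_moment x 1
     + 3 * n%:R * raw_moment x 2 ^+ 2
     - 6 * raw_moment x 4).
Proof.
have n4 : 4 <= n%:R :> R by rewrite ler_nat.
have n0 : 0 < n%:R :> R by lra.
have n1 : 0 < n%:R - 1 :> R by lra.
have n2 : 0 < n%:R - 2 :> R by lra.
have n3 : 0 < n%:R - 3 :> R by lra.
have N0 : 0 < n%:R * (n%:R - 1) * (n%:R - 2) * (n%:R - 3) :> R.
  by rewrite !mulr_gt0.
set G := geometric_mean x; set l := fun i => ln (x i / G).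
have G0 : 0 < G by apply: geometric_mean_gt0.
have l0 : \sum_i l i = 0.
  by apply: sum_ln_div_geometric_mean => //; apply: leq_trans hn.
pose p r := \sum_i x i ^+ r.
have le_sums : G ^+ 4 * (n%:R * (n%:R - 1) * (n%:R - 2) * (n%:R - 3)) <=
    p 1 ^+ 4 - 6 * p 2 * p 1 ^+ 2 + 8 * p 3 * p 1 + 3 * p 2 ^+ 2 - 6 * p 4.
  (* Both sides become sums over the same quadruples, so they can be compared term by term. *)
  have := distinct4_sum_affine _ _ _ l0; rewrite card_ord /= => <-.
  rewrite -distinct4_sum_prod /distinct4_sum.
  rewrite mulr_sumr; apply: ler_sum => a _.
  rewrite mulr_sumr; apply: ler_sum => b _.
  rewrite mulr_sumr; apply: ler_sum => c _.
  rewrite mulr_sumr; apply: ler_sum => d _.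
  exact: ln_div_bound4.
rewrite -(ler_pdivlMr _ _ N0) in le_sums.
apply: (le_trans le_sums); rewrite /raw_moment -!/(p _) le_eqVlt.
(* Equality holds here: [p r] is [n%:R] times the [r]-th moment, and one factor [n%:R] cancels
   against the denominator. *)
apply/orP; left; apply/eqP; field.
by rewrite !gt_eqF.
Qed.
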